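(* Let $K=\mathbb{F}_q$ be a finite field, let $S=K[t_1,\ldots,t_s]$, let $X$ be a subset of $\mathbb{A}^s=K^s$, let $I=I(X)$ be the vanishing ideal of $X$, and let $\prec$ be a graded monomial order on $S$. Then $$ {\rm fp}_{I}(d,r)\leq\delta_r(C_X(d))\quad\mbox{for } d\geq 1\mbox{ and }1\leq r\leq H_I^a(d). $$
   Context: $I(X)$ is the set of all $f\in S$ vanishing at every point of $X$. A monomial order is graded if monomials are first compared by total degree. ${\rm in}_\prec(I)$ is the initial ideal of $I$ and $\Delta_\prec(I)$ is the set of standard monomials of $S/I$, i.e. monomials not in ${\rm in}_\prec(I)$. $S_{\leq d}$ is the space of polynomials of degree at most $d$. Write $X=\{P_1,\ldots,P_m\}$ (distinct points). The Reed–Muller-type code of degree $d$ on $X$ is $C_X(d)=\{(f(P_1),\ldots,f(P_m))\mid f\in S_{\leq d}\}\subset K^m$. For integers $d,r\geq1$ let $\mathcal{M}_{\prec,d,r}$ be the set of all subsets $M$ of $\Delta_\prec(I)\cap S_{\leq d}$ with $r$ distinct elements. The $r$-th footprint of $C_X(d)$ is $$ {\rm fp}_I(d,r):=\deg(S/I)-\max\{\deg(S/({\rm in}_\prec(I),M))\mid M\in\mathcal{M}_{\prec,d,r}\}, $$ where $({\rm in}_\prec(I),M)$ is the ideal generated by ${\rm in}_\prec(I)\cup M$. For an ideal $J\subset S$, the affine Hilbert function is $H_J^a(d)=\dim_K(S_{\leq d}/J_{\leq d})$, with $J_{\leq d}=J\cap S_{\leq d}$. If $J\subsetneq S$ and $k=\dim(S/J)$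 (Krull dimension), then for $d\gg0$ $H_J^a(d)$ is a polynomial in $d$ of degree $k$ with leading coefficient $a_k$, and $\deg(S/J)=k!\,a_k$; $\deg(S/J)=0$ if $J=S$. In particular, if $k=0$, then $\deg(S/J)=\dim_K(S/J)$. For a linear code $C\subset K^m$ and $1\leq r\leq\dim_K C$, $\delta_r(C)=\min\{|\chi(D)| : D \text{ a linear subspace of } C,\ \dim_K D=r\}$, where $\chi(D)=\{i : \exists\,(a_1,\ldots,a_m)\in D,\ a_i\neq 0\}$. *)

(* Defs.v *)
From mathcomp Require Import all_boot all_order all_algebra.
From mathcomp Require Import boolp classical_sets.
From mathcomp Require Import mpoly.

Set Implicit Arguments.
Unset Strict Implicit.
Unset Printing Implicit Defensive.

Import Order.TTheory GRing.Theory Num.Theory.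

Local Open Scope ring_scope.
Local Open Scope classical_set_scope.

(* Both are meant for sets that do have a least (resp. greatest) element;
   the value is 0 otherwise. *)
Definition nat_min (A : set nat) : nat :=
  xget 0%N [set n | A n /\ forall k, A k -> (n <= k)%N].

Definition nat_max (A : set nat) : nat :=
  xget 0%N [set n | A n /\ forall k, A k -> (k <= n)%N].

Section Ideals.
Variables (s : nat) (K : fieldType).
Local Notation S := {mpoly K[s]}.

Definition is_ideal (J : set S) : Prop :=
  [/\ J 0, (forall f g, J f -> J g -> J (f + g))
    & (forall f g, J g -> J (f * g))].

Definition is_prime_ideal (J : set S) : Prop :=
  [/\ is_ideal J, J <> setT & forall f g, J (f * g) -> J f \/ J g].

Definition ideal_gen (A : set S) : set S :=
  [set f | exists (n : nat) (h g : 'I_n -> S),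
     (forall i, A (g i)) /\ f = \sum_(i < n) h i * g i].

(* Krull dimension of S/J: the primes of S/J are the primes of S that
   contain J, and a chain of length n has n + 1 members. *)
Definition prime_chain_over (J : set S) (n : nat) : Prop :=
  exists p : 'I_n.+1 -> set S,
    (forall i, is_prime_ideal (p i) /\ J `<=` p i) /\
    (forall i j : 'I_n.+1, (i < j)%N -> p i `<` p j).

Definition krull_dim_quot (J : set S) : nat := nat_max (prime_chain_over J).

(* msize f is the total degree plus one, and msize 0 = 0. *)
Definition deg_le (d : nat) : set S := [set f | (msize f <= d.+1)%N].

(* The classes of b_0, ..., b_(n-1) form a basis of V / (J `&` V). *)
Definition basis_mod (V J : set S) (n : nat) (b : 'I_n -> S) : Prop :=
  [/\ (forall i, V (b i)),
      (forall a : 'I_n -> K, J (\sum_(i < n) a i *: b i) -> forall i, a i = 0)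
    & (forall f, V f -> exists a : 'I_n -> K, J (f - \sum_(i < n) a i *: b i))].

Definition affine_hilbert (J : set S) (d : nat) : nat :=
  xget 0%N [set n | exists b : 'I_n -> S, basis_mod (deg_le d) J b].

Definition hilbert_poly (J : set S) : {poly rat} :=
  xget 0 [set p : {poly rat} | exists d0 : nat, forall d : nat,
     (d0 <= d)%N -> (affine_hilbert J d)%:R = p.[d%:R]].

Definition degree_quot (J : set S) : rat :=
  if `[< J = setT >] then 0
  else ((krull_dim_quot J)`!)%:R * (hilbert_poly J)`_(krull_dim_quot J).

End Ideals.

Section MonomialOrders.
Variables (s : nat) (K : fieldType).
Local Notation S := {mpoly K[s]}.

(* le a b stands for: 'X_[a] precedes or equals 'X_[b]. *)
Definition monomial_order (le : rel 'X_{1..s}) : Prop :=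
  [/\ total le, antisymmetric le, transitive le,
      (forall a b c : 'X_{1..s}, le a b -> le (a + c)%MM (b + c)%MM)
    & (forall a : 'X_{1..s}, le 0%MM a)].

Definition graded_monomial_order (le : rel 'X_{1..s}) : Prop :=
  monomial_order le /\
  forall a b : 'X_{1..s}, (mdeg a < mdeg b)%N -> le a b.

Definition is_lead_monomial (le : rel 'X_{1..s}) (f : S) (a : 'X_{1..s}) :
  Prop := a \in msupp f /\ forall b, b \in msupp f -> le b a.

Definition initial_ideal (le : rel 'X_{1..s}) (J : set S) : set S :=
  ideal_gen [set g | exists f a,
    [/\ J f, f != 0, is_lead_monomial le f a & g = 'X_[a]]].

Definition standard_monomials (le : rel 'X_{1..s}) (J : set S) :
  set 'X_{1..s} := [set a | ~ initial_ideal le J 'X_[a]].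

(* 'X_{1..s < d.+1} is the finite type of the monomials of degree <= d, so M
   ranges over finite sets of such monomials. *)
Definition footprint (le : rel 'X_{1..s}) (J : set S) (d r : nat) : rat :=
  degree_quot J -
  \big[Num.max/0]_(M : {set 'X_{1..s < d.+1}} |
       (#|M| == r) &&
       `[< forall a, a \in M -> standard_monomials le J (bmnm a) >])
    degree_quot (ideal_gen (initial_ideal le J `|`
                            [set g | exists2 a, a \in M & g = 'X_[bmnm a]])).

End MonomialOrders.

Section Codes.
Variable K : finFieldType.

Definition vanishing_ideal (s : nat) (X : {set 'rV[K]_s}) : set {mpoly K[s]} :=
  [set f | forall P, P \in X -> f.@[P ord0] = 0].

(* The points of X are numbered by enum_val : 'I_#|X| -> 'rV[K]_s. *)
Definition reed_muller_code (s : nat) (X : {set 'rV[K]_s}) (d : nat) :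
  set 'rV[K]_#|X| :=
  [set c | exists2 f : {mpoly K[s]},
     deg_le d f & c = \row_(i < #|X|) f.@[(enum_val i : 'rV[K]_s) ord0]].

Definition code_support (m : nat) (D : {vspace 'rV[K]_m}) : {set 'I_m} :=
  [set i | [exists a : 'rV[K]_m, (a \in D) && (a ord0 i != 0)]]%SET.

Definition gen_hamming_weight (m : nat) (C : set 'rV[K]_m) (r : nat) : nat :=
  nat_min [set w | exists D : {vspace 'rV[K]_m},
    [/\ (forall a, a \in D -> C a), \dim D = r & w = #|code_support D|]].

End Codes.

Arguments reed_muller_code [K s] X d _.

(* Main.v *)
(* A subspace D of C_X(d) of dimension r that attains the minimum support has
   |X| - |chi(D)| common zeros V in X. Reduced to standard monomials, which
   preserves the degree since the order is graded, the polynomials representing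
   D have at least r distinct leading monomials; r of these form a set M. Every
   monomial of J = (in(I), M) is the leading monomial of a polynomial vanishing
   on V, so the monomials outside J span the functions on V and
   deg(S/J) >= |V|, while deg(S/I) = |X|. All these quotients are
   finite-dimensional, and for them the degree defined through the Krull
   dimension and the Hilbert polynomial is the vector space dimension. *)
Require Import Defs.
From mathcomp Require Import all_boot all_order all_algebra.
From mathcomp Require Import finfield.
From mathcomp Require Import boolp classical_sets.
From mathcomp Require Import mpoly.

Set Implicit Arguments.
Unset Strict Implicit.
Unset Printing Implicit Defensive.

Import Order.TTheory GRing.Theory Num.Theory.

Local Open Scope ring_scope.

(** * Finite-dimensional quotients of the polynomial ring: Krull dimension and degree *)

Lemma exists_linear_relation (K : fieldType) m n (A : 'I_m -> 'I_n -> K) :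
    (n < m)%N ->
  exists2 k : 'I_m -> K, exists j, k j != 0 & forall i, \sum_j k j * A j i = 0.
Proof.
move=> ltnm; pose B := \matrix_(j, i) A j i.
have kB : kermx B != 0.
  rewrite -mxrank_eq0 mxrank_ker subn_eq0 -ltnNge.
  exact: leq_ltn_trans (rank_leq_col _) ltnm.
have [k /sub_kermxP kB0 /rV0Pn[j kj]] := rowV0Pn kB.
exists (k ord0) => [|i]; first by exists j.
have /rowP/(_ i) := kB0; rewrite !mxE => {2}<-.
by apply: eq_bigr => j' _; rewrite mxE.
Qed.

Section IdealQuotients.
Variables (s : nat) (K : fieldType).
Local Notation S := {mpoly K[s]}.
Implicit Types (J : set S) (f g : S).

Lemma is_idealZ J c f : is_ideal J -> J f -> J (c *: f).
Proof. by case=> _ _ JM Jf; rewrite -mul_mpolyC; apply: JM. Qed.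

Lemma is_idealB J f g : is_ideal J -> J f -> J g -> J (f - g).
Proof.
move=> JI Jf Jg; rewrite -scaleN1r.
by case: (JI) => _ JD _; apply: JD => //; apply: is_idealZ.
Qed.

Lemma is_ideal_sum J (I : Type) (t : seq I) (P : pred I) (F : I -> S) :
  is_ideal J -> (forall i, P i -> J (F i)) -> J (\sum_(i <- t | P i) F i).
Proof. by case=> J0 JD _ JF; apply: big_ind. Qed.

(** Steinitz exchange modulo [J]: if [n < m], the coefficient vectors of the [c j] satisfy a
    nontrivial relation, which carries over to a combination of the [c j] lying in [J]. *)
Lemma independent_leq_spanning J m n (b : 'I_n -> S) (c : 'I_m -> S) :
    is_ideal J ->
    (forall j, exists a : 'I_n -> K, J (c j - \sum_(i < n) a i *: b i)) ->
    (forall a : 'I_m -> K, J (\sum_(j < m) a j *: c j) -> forall j, a j = 0) ->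
  (m <= n)%N.
Proof.
move=> JI /choice[A JA] cfree; rewrite leqNgt; apply/negP => ltnm.
have [k [j kj] kA] := exists_linear_relation A ltnm.
case/eqP: kj; apply: cfree.
suff -> : \sum_(j < m) k j *: c j =
    \sum_(j < m) k j *: (c j - \sum_(i < n) A j i *: b i).
  by apply: is_ideal_sum => // j' _; apply: is_idealZ.
under [RHS]eq_bigr do rewrite scalerBr.
rewrite sumrB -[LHS]subr0; congr (_ - _).
under eq_bigr do rewrite scaler_sumr.
rewrite exchange_big big1 //= => i _.
under eq_bigr do rewrite scalerA.
by rewrite -scaler_suml kA scale0r.
Qed.

Lemma affine_hilbertE J d n (b : 'I_n -> S) :
  is_ideal J -> basis_mod (deg_le d) J b -> affine_hilbert J d = n.
Proof.
move=> JI [bV bfree bspan]; apply: xget_unique; first by exists b.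
move=> m [c [cV cfree cspan]]; apply/eqP; rewrite eqn_leq.
apply/andP; split; apply: (independent_leq_spanning JI); eauto.
Qed.

(** A prime [p0] over [J] cannot lie strictly below a prime [p1]. Otherwise take [f] in [p1] but not
    in [p0]: cancelling powers of [f] modulo [p0] in a relation among its powers would put a nonzero
    constant into [p1]. Hence all powers of [f] are independent modulo [J], against the bound
    [n]. *)
Lemma krull_dim_quot0 J d0 n (b : 'I_n -> S) :
    (forall d, (d0 <= d)%N -> basis_mod (deg_le d) J b) -> is_ideal J ->
  krull_dim_quot J = 0%N.
Proof.
move=> bb JI; suff ch0 k : prime_chain_over J k -> k = 0%N.
  (* The default value 0 of [nat_max] agrees with the claim when there is no chain at all. *)
  rewrite /krull_dim_quot /nat_max; case: xgetP => [k _ [+ _]|//].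
  exact: ch0.
case: k => // k [p [pP plt]]; exfalso.
have := plt ord0 (lift ord0 ord0) isT.
set p0 := p ord0; set p1 := p _ => -[sub01 nsub10].
have [[p0I _ p0M] Jp0] : is_prime_ideal p0 /\ (J `<=` p0)%classic by apply: pP.
have [[p1I p1T _] _] : is_prime_ideal p1 /\ (J `<=` p1)%classic by apply: pP.
apply: nsub10 => f p1f; apply: contrapT => p0f.
(* This [d] is large enough for the [n.+1] powers of [f] to lie in a space that has [n] basis
   elements modulo [J]. *)
pose d := (d0 + \sum_(j < n.+1) msize (f ^+ j))%N.
have fV (j : 'I_n.+1) : deg_le d (f ^+ j).
  by rewrite /deg_le /= /d (bigD1 j) //= addnCA -addnS leq_addr.
have [_ _ bspan] := bb d (leq_addr _ _).
suff: (n.+1 <= n)%N by rewrite ltnn.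
apply: (independent_leq_spanning JI (c := fun j => f ^+ j)); first by eauto.
move=> a Ja j; have [N] := ubnP (val j); elim: N j => // N IH j ltjN.
have a0 (i : 'I_n.+1) : (i < j)%N -> a i = 0.
  by move=> ltij; apply: IH; apply: leq_trans ltij _.
pose g := \sum_(i < n.+1 | (j < i)%N) a i *: f ^+ (i - j.+1).
(* With the lower coefficients already zero, [f ^+ j] factors out and leaves [a j] plus a multiple
   of [f]. *)
have Esum : \sum_(i < n.+1) a i *: f ^+ i = f ^+ j * ((a j)%:MP + g * f).
  rewrite (bigID (fun i : 'I_n.+1 => (i < j)%N)) /= big1 ?add0r; last first.
    by move=> i /a0 ->; rewrite scale0r.
  rewrite (bigD1 j) ?ltnn //= mulrDr [f ^+ j * _%:MP]mulrC mul_mpolyC.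
  congr (_ + _); rewrite mulr_suml mulr_sumr; apply: eq_big => [i|i].
    by rewrite -leqNgt ltn_neqAle eq_sym andbC.
  rewrite -leqNgt => /andP[leji neij].
  have ltji : (j < i)%N by rewrite ltn_neqAle leji andbT eq_sym.
  by rewrite -scalerAl -scalerAr -exprSr -exprD -addSnnS subnKC.
have p0N1 : ~ p0 1.
  move=> p01; apply: p0f; rewrite -[f]mulr1.
  by case: p0I => _ _; apply.
have p0fX i : ~ p0 (f ^+ i).
  by elim: i => [|i IHi]; rewrite ?expr0 // exprS => /p0M[].
have /Jp0 := Ja; rewrite Esum => /p0M[/p0fX//|/sub01 p1a].
apply: contrapT => /eqP aj0; apply: p1T.
have p1aj : p1 (a j)%:MP.
  rewrite -[_%:MP](addrK (g * f)); apply: is_idealB => //.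
  by case: p1I => _ _; apply.
apply/seteqP; split => // h _; have [_ _ p1M] := p1I.
have -> : h = (h * (a j)^-1%:MP) * (a j)%:MP.
  by rewrite -mulrA -mpolyCM mulVf // mulr1.
exact: p1M.
Qed.

(** The affine Hilbert function is eventually the constant [n], so the Hilbert polynomial is that
    constant, and the Krull dimension is 0. *)
Lemma degree_quotE J d0 n (b : 'I_n -> S) :
    is_ideal J -> (forall d, (d0 <= d)%N -> basis_mod (deg_le d) J b) ->
  degree_quot J = n%:R.
Proof.
move=> JI bb; rewrite /degree_quot; case: asboolP => [JT|_].
  (* For [J = S] only the empty family is independent, so [n] is 0 as the convention requires. *)
  case: n b bb => // n b /(_ d0 (leqnn _))[_ bfree _].
  suff /eqP : (1 : K) = 0 by rewrite oner_eq0.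
  by apply: (bfree (fun=> 1) _ ord0); rewrite JT.
rewrite (krull_dim_quot0 bb JI) mul1r.
suff -> : hilbert_poly J = n%:R%:P by rewrite coefC.
have bn d : (d0 <= d)%N -> affine_hilbert J d = n.
  by move=> /bb; apply: affine_hilbertE.
apply: xget_unique; first by exists d0 => d /bn ->; rewrite hornerC.
move=> p [d1 p_eq]; apply/eqP; rewrite -subr_eq0; apply/negPn/negP => pn0.
(* The nonzero difference would vanish at as many integers as its [size], one more than its
   degree. *)
pose t := [seq i%:R : rat | i <- iota (d0 + d1) (size (p - n%:R%:P))].
have /(max_poly_roots pn0) : all (root (p - n%:R%:P)) t.
  apply/allP => _ /mapP[i + ->]; rewrite mem_iota => /andP[lei _].
  rewrite rootE !hornerE -p_eq ?bn ?subrr //.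
    exact: leq_trans (leq_addr _ _) lei.
  exact: leq_trans (leq_addl _ _) lei.
rewrite map_inj_uniq ?iota_uniq; last first.
  by move=> x y /eqP; rewrite eqr_nat => /eqP.
by rewrite size_map size_iota ltnn => /(_ isT).
Qed.

End IdealQuotients.

(** * Monomial ideals and their standard monomials *)

Section MonomialIdeals.
Variables (s : nat) (K : fieldType).
Local Notation S := {mpoly K[s]}.
Implicit Types (A J : set S) (f g : S).

Lemma ideal_gen_is_ideal A : is_ideal (ideal_gen A).
Proof.
split.
- by exists 0%N, (fun=> 0), (fun=> 0); split=> [[]//|]; rewrite big_ord0.
- move=> _ _ [m [h [g [Ag ->]]]] [n [h' [g' [Ag' ->]]]].
  pose glue (u : 'I_m -> S) (v : 'I_n -> S) i :=
    match split i with inl j => u j | inr j => v j end.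
  exists (m + n)%N, (glue h h'), (glue g g'); split=> [i|].
    by rewrite /glue; case: split.
  by rewrite big_split_ord; congr (_ + _); apply: eq_bigr => i _;
    rewrite /glue (unsplitK (inl i), unsplitK (inr i)).
- move=> f _ [m [h [g [Ag ->]]]]; exists m, (fun i => f * h i), g; split=> //.
  by rewrite mulr_sumr; under eq_bigr do rewrite mulrA.
Qed.

Lemma sub_ideal_gen A g : A g -> ideal_gen A g.
Proof.
move=> Ag; exists 1%N, (fun=> 1), (fun=> g); split=> //.
by rewrite big_ord1 mul1r.
Qed.

(** Each monomial of a combination of generators is a multiple of a monomial of some generator. This
    transfers any property stable under multiplication by monomials from the generators to the whole
    ideal. *)
Lemma ideal_gen_msupp A (Q : 'X_{1..s} -> Prop) :
    (forall a c, Q a -> Q (c + a)%MM) ->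
    (forall g, A g -> forall a, a \in msupp g -> Q a) ->
  forall f, ideal_gen A f -> forall a, a \in msupp f -> Q a.
Proof.
move=> QD AQ _ [n [h [g [Ag ->]]]] a /msupp_sum_le /flatten_mapP[i _].
move=> /msuppM_le /allpairsP[[c b] /= [_ bg ->]].
by apply: QD; apply: AQ bg.
Qed.

Lemma ideal_gen_msuppX A :
    (forall g, A g -> forall a, a \in msupp g -> ideal_gen A 'X_[a]) ->
  forall f, ideal_gen A f -> forall a, a \in msupp f -> ideal_gen A 'X_[a].
Proof.
apply: ideal_gen_msupp => a c; rewrite mpolyXD.
by have [_ _] := ideal_gen_is_ideal A; apply.
Qed.

Lemma mcoeff_sum_enum N (T : {set 'X_{1..s < N}}) (a : 'I_#|T| -> K) j :
  (\sum_(i < #|T|) a i *: 'X_[bmnm (enum_val i)])@_(bmnm (enum_val j)) = a j.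
Proof.
rewrite raddf_sum (bigD1 j) //= mcoeffZ mcoeffX eqxx mulr1 big1 ?addr0 // => i.
move=> neij; rewrite mcoeffZ mcoeffX; case: eqP => [/val_inj/enum_val_inj|].
  by move=> eqij; rewrite eqij eqxx in neij.
by rewrite mulr0.
Qed.

Lemma mpoly_sum_enum N (T : {set 'X_{1..s < N}}) f :
    (forall a, a \in msupp f -> exists2 b, b \in T & a = bmnm b) ->
  f = \sum_(i < #|T|) f@_(bmnm (enum_val i)) *: 'X_[bmnm (enum_val i)].
Proof.
move=> fT; apply/mpolyP => a.
have [[b bT ->]|Ta] := pselect (exists2 b, b \in T & a = bmnm b).
  by rewrite -[b](enum_rankK_in bT bT) mcoeff_sum_enum.
have [/fT//|/memN_msupp_eq0->] := boolP (a \in msupp f).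
rewrite raddf_sum big1 //= => i _; rewrite mcoeffZ mcoeffX.
case: eqP => [ia|]; last by rewrite mulr0.
by case: Ta; exists (enum_val i) => //; apply: enum_valP.
Qed.

Lemma degree_quot_monomial J d :
    is_ideal J ->
    (forall f, J f -> forall a, a \in msupp f -> J 'X_[a]) ->
    (forall a, ~ J 'X_[a] -> (mdeg a <= d)%N) ->
  degree_quot J =
  #|[set a : 'X_{1..s < d.+1} | ~~ `[< J 'X_[bmnm a] >]]%SET|%:R.
Proof.
move=> JI JX Jd; set T := [set a | _]%SET.
have TP (i : 'I_#|T|) : ~ J 'X_[bmnm (enum_val i)].
  by have := enum_valP i; rewrite inE => /asboolPn.
apply: (degree_quotE (d0 := d)
  (b := fun i : 'I_#|T| => 'X_[bmnm (enum_val i)])) => // e led.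
split=> [i|a Ja i|f _].
- by rewrite /deg_le /= msizeX ltnS (leq_trans _ led) // -ltnS bmdeg.
- apply: contrapT => /eqP ai; apply: (TP i); apply: JX Ja _ _.
  by rewrite mcoeff_msupp mcoeff_sum_enum.
exists (fun i => f@_(bmnm (enum_val i))); set h := _ - _.
rewrite [h]mpolyE big_seq_cond; apply: is_ideal_sum => // m /andP[mh _].
apply: is_idealZ => //; apply: contrapT => Jm.
have ltm : (mdeg m < d.+1)%N by apply: Jd.
have [i mE] : exists i : 'I_#|T|, m = bmnm (enum_val i).
  have mT : BMultinom ltm \in T by rewrite inE; apply/asboolPn.
  by exists (enum_rank_in mT (BMultinom ltm)); rewrite enum_rankK_in.
by move: mh; rewrite mcoeff_msupp /h mcoeffB mE mcoeff_sum_enum subrr eqxx.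
Qed.

End MonomialIdeals.

(** * Leading monomials and division for a graded order *)

Section GradedOrders.
Variables (s : nat) (K : fieldType) (le : rel 'X_{1..s}).
Hypothesis hle : graded_monomial_order le.
Local Notation S := {mpoly K[s]}.
Implicit Types (J : set S) (f g : S).

Let le_total : total le. Proof. by have [[]] := hle. Qed.
Let le_anti : antisymmetric le. Proof. by have [[]] := hle. Qed.
Let le_trans : transitive le. Proof. by have [[]] := hle. Qed.
Let le_refl : reflexive le.
Proof. by move=> a; have := le_total a a; case: le. Qed.

Lemma graded_mdeg_le a b : le a b -> (mdeg a <= mdeg b)%N.
Proof.
move=> leab; rewrite leqNgt; apply/negP => ltba.
have leba : le b a by have [_] := hle; apply.
by move: ltba; rewrite (le_anti (x := a) (y := b)) ?leab ?leba ?ltnn.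
Qed.

Lemma exists_lead_monomial f : f != 0 -> exists a, is_lead_monomial le f a.
Proof.
rewrite -msupp_eq0 /is_lead_monomial; elim: (msupp f) => // a t IH _.
have [->|/IH[b [bt bmax]]] := eqVneq t [::].
  by exists a; split=> [|b]; rewrite ?inE ?eqxx // => /eqP->.
have [leab|leba] := orP (le_total a b).
  exists b; split=> [|c]; first by rewrite inE bt orbT.
  by rewrite inE => /predU1P[->//|/bmax].
exists a; split=> [|c]; first by rewrite inE eqxx.
by rewrite inE => /predU1P[->//|/bmax lecb]; apply: le_trans lecb leba.
Qed.

Lemma is_lead_monomialM f a c :
  is_lead_monomial le f a -> is_lead_monomial le (f * 'X_[c]) (c + a)%MM.
Proof.
have [[_ _ _ leD _] _] := hle.
move=> [af amax]; split=> [|b]; rewrite (perm_mem (msuppMX _ _)).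
  by rewrite map_f.
by move=> /mapP[b' /amax leb ->]; rewrite addmC [(c + a)%MM]addmC leD.
Qed.

(** Leading monomials of elements of [J] are stable under multiplication by monomials, so the ideal
    they generate contains no further monomials. *)
Lemma initial_idealX J a :
    is_ideal J -> initial_ideal le J 'X_[a] ->
  exists f, J f /\ is_lead_monomial le f a.
Proof.
move=> [_ _ JM] Ja; apply: (ideal_gen_msupp (a := a)
  (Q := fun a => exists f, J f /\ is_lead_monomial le f a) _ _ Ja); last first.
- by rewrite msuppX mem_head.
- by move=> _ [f [b [Jf _ fb ->]]] c; rewrite msuppX inE => /eqP->; exists f.
move=> b c [f [Jf fb]]; exists (f * 'X_[c]).
by split; [rewrite mulrC; apply: JM | apply: is_lead_monomialM].
Qed.

Lemma lead_initial_ideal J f a :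
  J f -> is_lead_monomial le f a -> initial_ideal le J 'X_[a].
Proof.
move=> Jf fa; apply: sub_ideal_gen; exists f, a; split=> //.
by case: fa => + _; apply: contraTneq => ->; rewrite msupp0.
Qed.

Lemma initial_ideal_msuppX J f a :
  initial_ideal le J f -> a \in msupp f -> initial_ideal le J 'X_[a].
Proof.
move=> Jf; apply: ideal_gen_msuppX Jf a => _ [f' [a [Jf f0 fa ->]]] b.
rewrite msuppX inE => /eqP->.
exact: lead_initial_ideal fa.
Qed.

(** Division: a monomial outside [T] leads some element of [J] and is replaced by smaller terms,
    whose degree is no larger since the order is graded. [T] contains the standard monomials of [J]
    but may be larger, which the final comparison uses. *)
Lemma normal_form J (T : 'X_{1..s} -> Prop) d g :
    is_ideal J ->
    (forall a, ~ T a -> exists f, J f /\ is_lead_monomial le f a) ->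
    deg_le d g ->
  exists f, [/\ deg_le d f, forall a, a \in msupp f -> T a & J (g - f)].
Proof.
move=> JI JT.
pose P g := exists f,
  [/\ deg_le d f, forall a, a \in msupp f -> T a & J (g - f)].
have P0 : P 0.
  exists 0; split; first by rewrite /deg_le /= mmeasure0.
    by move=> a; rewrite msupp0.
  by rewrite subr0; case: JI.
have PD u v : P u -> P v -> P (u + v).
  move=> [u' [du Tu Ju]] [v' [dv Tv Jv]]; exists (u' + v'); split.
  - by rewrite /deg_le /= (leq_trans (msizeD_le _ _)) // geq_max du.
  - by move=> a /msuppD_le; rewrite mem_cat => /orP[/Tu|/Tv].
  - by rewrite opprD addrACA; case: JI => _ JD _; apply: JD.
have PZ c u : P u -> P (c *: u).
  move=> [u' [du Tu Ju]]; exists (c *: u'); split.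
  - by rewrite /deg_le /= (leq_trans (msizeZ_le _ _)).
  - by move=> a /msuppZ_le /Tu.
  - by rewrite -scalerBr; apply: is_idealZ.
(* Termination: the monomials of degree at most [d] are finite in number, and [rk] counts those not
   exceeding [a]. *)
pose rk a := #|[set b : 'X_{1..s < d.+1} | le (bmnm b) a]%SET|.
suff PX a : (mdeg a <= d)%N -> P 'X_[a].
  rewrite /deg_le /= => dg; rewrite -/(P g) [g]mpolyE big_seq.
  apply: (big_ind P) => // a ag; apply: PZ; apply: PX.
  by rewrite -ltnS (leq_trans (msize_mdeg_lt ag)).
have [N] := ubnP (rk a); elim: N a => // N IH a rka da.
have [Ta|/JT[f [Jf [af amax]]]] := pselect (T a).
  exists 'X_[a]; split; first by rewrite /deg_le /= msizeX.
    by move=> b; rewrite msuppX inE => /eqP->.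
  by rewrite subrr; case: JI.
rewrite mcoeff_msupp in af.
(* Solve [f] for its leading term. *)
have -> : 'X_[a] = (f@_a)^-1 *: f - \sum_(b <- msupp f | b != a)
    ((f@_a)^-1 * f@_b) *: 'X_[b].
  rewrite [X in _ *: X - _]mpolyE (bigD1_seq a) ?msupp_uniq ?mcoeff_msupp //=.
  rewrite scalerDr scalerA mulVf // scale1r scaler_sumr.
  by under [in X in _ - X]eq_bigr do rewrite -scalerA; rewrite addrK.
apply: (PD); last rewrite -scaleN1r; last apply: (PZ).
  exists 0; split; first by rewrite /deg_le /= mmeasure0.
    by move=> b; rewrite msupp0.
  by rewrite subr0; apply: is_idealZ.
rewrite big_seq_cond; apply: (big_ind P) => // b /andP[/amax leba neba].
apply: PZ; apply: IH; last exact: leq_trans (graded_mdeg_le leba) da.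
rewrite ltnS in rka; apply: leq_trans rka; apply: proper_card.
have lta : (mdeg a < d.+1)%N by [].
apply/properP; split.
  by apply/fintype.subsetP => c; rewrite !inE => /le_trans; apply.
exists (BMultinom lta); rewrite !inE //=; apply/negP => leab.
by move/eqP: neba; apply; apply: le_anti; rewrite leba.
Qed.

End GradedOrders.

Lemma nat_min_mem (A : set nat) : (exists n, A n) -> A (nat_min A).
Proof.
move=> [n An]; rewrite /nat_min; case: xgetP => [m _ []//|noA].
have exA : exists n, `[< A n >] by exists n; apply/asboolP.
case: (ex_minnP exA) => m /asboolP Am mmin; case: (noA m); split=> // k Ak.
by apply: mmin; apply/asboolP.
Qed.

(** * Vanishing ideals of point sets over a finite field *)

Section VanishingIdeals.
Variables (s : nat) (K : finFieldType).
Local Notation S := {mpoly K[s]}.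
Implicit Types (X : {set 'rV[K]_s}) (P Q : 'rV[K]_s) (f g : S).

Lemma vanishing_ideal_is_ideal X : is_ideal (vanishing_ideal X).
Proof.
split=> [P _|f g fX gX P PX|f g gX P PX]; first exact: meval0.
  by rewrite mevalD fX // gX // addr0.
by rewrite mevalM gX // mulr0.
Qed.

(** Nonzero elements of [K] have [#|K|.-1]-th power 1, so a factor is 1 where the coordinate agrees
    with that of [P] and 0 elsewhere. *)
Definition point_indicator P : S :=
  \prod_(i < s) (1 - ('X_i - (P ord0 i)%:MP) ^+ #|K|.-1).

Lemma meval_point_indicator P Q :
  (point_indicator P).@[Q ord0] = (Q == P)%:R.
Proof.
rewrite /point_indicator rmorph_prod /=.
under eq_bigr do rewrite mevalB meval1 rmorphXn /= mevalB mevalXU mevalC.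
have q_gt1 := finNzRing_gt1 K.
have [->|neQP] := eqVneq Q P.
  rewrite big1 // => i _.
  by rewrite subrr expr0n -subn1 subn_eq0 leqNgt q_gt1 subr0.
have /rV0Pn[i] : Q - P != 0 by rewrite subr_eq0.
rewrite !mxE => di; rewrite (bigD1 i) //=.
suff -> : (Q ord0 i - P ord0 i) ^+ #|K|.-1 = 1 by rewrite subrr mul0r.
by apply: (mulfI di); rewrite -exprS prednK ?expf_card ?mulr1 // ltnW.
Qed.

Lemma meval_sum_indicator X (a : 'I_#|X| -> K) j :
  let f := \sum_(i < #|X|) a i *: point_indicator (enum_val i) in
  f.@[(enum_val j : 'rV[K]_s) ord0] = a j.
Proof.
rewrite /= rmorph_sum (bigD1 j) //= mevalZ meval_point_indicator eqxx mulr1.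
rewrite big1 ?addr0 // => i neij; rewrite mevalZ meval_point_indicator.
by rewrite (inj_eq enum_val_inj) eq_sym (negPf neij) mulr0.
Qed.

Lemma point_indicators_free X (a : 'I_#|X| -> K) :
    vanishing_ideal X (\sum_(i < #|X|) a i *: point_indicator (enum_val i)) ->
  forall i, a i = 0.
Proof. by move=> aX i; rewrite -meval_sum_indicator aX // enum_valP. Qed.

(** By interpolation, the indicators of the points of [X] form a basis modulo the vanishing
    ideal. *)
Lemma degree_quot_vanishing_ideal X :
  degree_quot (vanishing_ideal X) = #|X|%:R.
Proof.
pose d0 := (\sum_(i < #|X|) msize (point_indicator (enum_val i)))%N.
apply: (degree_quotE (d0 := d0)
  (b := fun i : 'I_#|X| => point_indicator (enum_val i))).
  exact: vanishing_ideal_is_ideal.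
move=> d led; split=> [i||f _]; last 2 first.
- exact: point_indicators_free.
- exists (fun i => f.@[(enum_val i : 'rV[K]_s) ord0]) => P PX.
  by rewrite -[P](enum_rankK_in PX PX) mevalB meval_sum_indicator subrr.
apply/leqW/(leq_trans _ led).
by rewrite /d0 (bigD1 i) //= leq_addr.
Qed.

(* 'X_i ^+ #|K| - 'X_i vanishes everywhere, so exponents of standard monomials
   are smaller than #|K|. *)
Lemma standard_monomial_bounded (le : rel 'X_{1..s}) X a :
    graded_monomial_order le ->
    ~ initial_ideal le (vanishing_ideal X) 'X_[a] ->
  (mdeg a <= s * #|K|)%N.
Proof.
move=> [[le_total _ _ _ _] gle] std.
rewrite mdegE -[s in (s * _)%N]card_ord -sum_nat_const.
apply: leq_sum => i _; rewrite leqNgt; apply/negP => lti; apply: std.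
have q_gt1 := finNzRing_gt1 K.
have qa : (U_(i) *+ #|K| <= a)%MM.
  apply/mnm_lepP => j; rewrite mulmnE mnm1E.
  by case: eqP => [<-|]; rewrite ?mul1n ?mul0n // ltnW.
have [_ _ inM] : is_ideal (initial_ideal le (vanishing_ideal X)).
  exact: ideal_gen_is_ideal.
rewrite -(submK qa) mpolyXD; apply: inM.
apply: (@lead_initial_ideal _ _ _ _ ('X_i ^+ #|K| - 'X_i)).
  by move=> P _; rewrite mevalB rmorphXn /= mevalXU expf_card subrr.
(* The two terms do not cancel, as [#|K|] exceeds 1. *)
have neU : (U_(i) == U_(i) *+ #|K|)%MM = false.
  apply/eqP => /(congr1 mdeg); rewrite mdegMn mdeg1 mul1n => q1.
  by rewrite -q1 in q_gt1.
rewrite mpolyXn; split.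
  by rewrite mcoeff_msupp mcoeffB !mcoeffX eqxx neU subr0 oner_eq0.
move=> b /msuppB_le; rewrite mem_cat !msuppX !inE => /orP[] /eqP->; last first.
  by apply: gle; rewrite mdegMn mdeg1 mul1n.
by case: (orP (le_total (U_(i) *+ #|K|)%MM (U_(i) *+ #|K|)%MM)).
Qed.

End VanishingIdeals.

(** * Subcodes: their dimension, leading monomials and common zeros *)

Section Subcodes.
Variables (s : nat) (K : finFieldType) (X : {set 'rV[K]_s}).
Local Notation S := {mpoly K[s]}.
Local Notation I := (vanishing_ideal X).
Implicit Types (f g : S) (D : {vspace 'rV[K]_#|X|}).

Definition eval_row f : 'rV[K]_#|X| :=
  \row_(i < #|X|) f.@[(enum_val i : 'rV[K]_s) ord0].

Lemma eval_row_sum n (k : 'I_n -> K) (f : 'I_n -> S) :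
  eval_row (\sum_(i < n) k i *: f i) = \sum_(i < n) k i *: eval_row (f i).
Proof.
apply/rowP => j; rewrite mxE raddf_sum summxE.
by apply: eq_bigr => i _; rewrite !mxE /= mevalZ.
Qed.

Lemma eval_row_eq0 f : eval_row f = 0 <-> I f.
Proof.
split=> [/rowP f0 P PX|fX]; last first.
  by apply/rowP => i; rewrite !mxE fX // enum_valP.
by rewrite -[P](enum_rankK_in PX PX); have := f0 (enum_rank_in PX P);
  rewrite !mxE.
Qed.

Lemma eval_row_congr f g : I (g - f) -> eval_row f = eval_row g.
Proof.
move=> /eval_row_eq0/rowP gf; apply/rowP => i; apply/esym/eqP.
by rewrite -subr_eq0 !mxE -mevalB; have := gf i; rewrite !mxE => ->.
Qed.

(** Guarantees that the minimum defining the generalized Hamming weight is over a nonempty set and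
    hence attained. Independence modulo the vanishing ideal is independence of the evaluation
    vectors. *)
Lemma exists_subcode d r : (r <= affine_hilbert I d)%N ->
  exists D, (forall a, a \in D -> reed_muller_code X d a) /\ \dim D = r.
Proof.
rewrite /affine_hilbert; case: xgetP => [n _ [b [bd bfree _]] ler|_];
  last first.
  (* Without a finite basis the Hilbert function takes its default 0, which forces [r = 0]. *)
  rewrite leqn0 => /eqP->; exists 0%VS; rewrite dimv0; split=> // a.
  rewrite memv0 => /eqP->; exists 0; first by rewrite /deg_le /= mmeasure0.
  by apply/esym/eval_row_eq0; case: (vanishing_ideal_is_ideal X).
pose e := [tuple eval_row (b (widen_ord ler i)) | i < r].
have eE (k : 'I_r -> K) : \sum_(i < r) k i *: e`_i =
    eval_row (\sum_(i < r) k i *: b (widen_ord ler i)).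
  by rewrite eval_row_sum; apply: eq_bigr => i _;
    rewrite -tnth_nth tnth_mktuple.
exists <<e>>%VS; split=> [a ae|]; last first.
  suff /eqP-> : free e by rewrite size_tuple.
  apply/freeP => k; rewrite eE => /eval_row_eq0 kI i.
  (* Extend the coefficients by zero to the whole basis. *)
  pose k' (j : 'I_n) :=
    if insub (val j) : option 'I_r is Some i then k i else 0.
  have k'E j : k' (widen_ord ler j) = k j by rewrite /k' valK.
  rewrite -k'E; apply: bfree.
  rewrite (bigID (fun j : 'I_n => (j < r)%N)) /= [X in _ + X]big1 ?addr0.
    have -> : \sum_(j < n | (j < r)%N) k' j *: b j =
        \sum_(i < r) k i *: b (widen_ord ler i); last by [].
    rewrite (big_ord_narrow ler) /=.
    by apply: eq_bigr => j _; rewrite k'E.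
  by move=> j ltjr; rewrite /k' insubN ?scale0r.
rewrite (coord_span ae) eE; eexists; last by [].
apply: (big_ind (deg_le d)) => [|f g df dg|i _]; rewrite /deg_le /=.
- by rewrite mmeasure0.
- by rewrite (leq_trans (msizeD_le _ _)) // geq_max df.
- by rewrite (leq_trans (msizeZ_le _ _)) //; apply: bd.
Qed.

Section LeadMonomials.
Variable le : rel 'X_{1..s}.
Hypothesis hle : graded_monomial_order le.

(** Here [f] is any polynomial with values in [D], reduced or not; standardness of its leading
    monomial excludes elements of the vanishing ideal. *)
Definition lead_monomials D d : {set 'X_{1..s < d.+1}} :=
  [set a : 'X_{1..s < d.+1} | `[< standard_monomials le I (bmnm a) /\
     exists f, eval_row f \in D /\ is_lead_monomial le f (bmnm a) >]]%SET.

(* A standard normal form of a nonzero codeword of D cannot vanish at every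
   lead monomial, so D embeds into the space of coefficients there. *)
Lemma dim_leq_lead_monomials D d :
    (forall a, a \in D -> reed_muller_code X d a) ->
  (\dim D <= #|lead_monomials D d|)%N.
Proof.
move=> DC; set L := lead_monomials D d.
have /choice[f fP] : forall j : 'I_(\dim D), exists f, [/\ deg_le d f,
    forall a, a \in msupp f -> standard_monomials le I a &
    eval_row f = (vbasis D)`_j].
  move=> j; have [|g dg ->] := DC (vbasis D)`_j.
    by apply/vbasis_mem/mem_nth; rewrite size_tuple.
  have [a|f [df fT fg]] := normal_form hle (T := standard_monomials le I)
      (vanishing_ideal_is_ideal X) _ dg.
    move=> /contrapT; apply: initial_idealX => //.
    exact: vanishing_ideal_is_ideal.
  by exists f; split=> //; apply: eval_row_congr.
rewrite leqNgt; apply/negP => ltLD.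
have [k [j kj] kL] := exists_linear_relation
  (fun j (i : 'I_#|L|) => (f j)@_(bmnm (enum_val i))) ltLD.
set h := \sum_(j < \dim D) k j *: f j.
have hE : eval_row h = \sum_j k j *: (vbasis D)`_j.
  by rewrite eval_row_sum; apply: eq_bigr => i _; have [_ _ ->] := fP i.
have h0 : h != 0.
  apply/eqP => h0; case/eqP: kj.
  have /freeP := basis_free (vbasisP D); apply; rewrite -hE h0.
  by apply/eval_row_eq0; case: (vanishing_ideal_is_ideal X).
have [a [ah amax]] := exists_lead_monomial hle h0.
(* The leading monomial of [h] already occurs in some [f i], hence is standard of degree at most
   [d]. *)
have /flatten_mapP[i _ /msuppZ_le afi] := msupp_sum_le ah.
have [dfi fiT _] := fP i.
have lta : (mdeg a < d.+1)%N by apply: leq_trans (msize_mdeg_lt afi) dfi.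
have aL : BMultinom lta \in L.
  rewrite inE; apply/asboolP; split; first exact: fiT.
  exists h; split=> //; rewrite hE; apply: memv_suml => i' _.
  by apply/memvZ/vbasis_mem/mem_nth; rewrite size_tuple.
move: ah; rewrite mcoeff_msupp => /eqP; apply.
rewrite -[a]/(bmnm (BMultinom lta)) -(enum_rankK_in aL aL).
rewrite raddf_sum -[RHS](kL (enum_rank_in aL (BMultinom lta))).
by apply: eq_bigr => i' _; rewrite /= mcoeffZ.
Qed.

End LeadMonomials.

Definition common_zeros D : {set 'rV[K]_s} :=
  (enum_val @: ~: code_support D)%SET.

Lemma card_common_zeros D : (#|common_zeros D| + #|code_support D|)%N = #|X|.
Proof.
rewrite /common_zeros (card_imset _ enum_val_inj) addnC.
by rewrite (cardsC (code_support D)) card_ord.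
Qed.

Lemma vanishing_common_zeros D f :
  eval_row f \in D -> vanishing_ideal (common_zeros D) f.
Proof.
move=> fD _ /imsetP[i + ->].
rewrite !inE negb_exists => /forallP/(_ (eval_row f)).
by rewrite fD negbK mxE => /eqP.
Qed.

End Subcodes.

(** * Comparison of degrees and conclusion *)

(** The indicators of the points of [V] are independent modulo its vanishing ideal, and division
    rewrites each one with monomials outside [J]. Here [d] only bounds those monomials; it is not
    the degree of the code. *)
Lemma card_leq_standard_monomials (s : nat) (K : finFieldType)
    (le : rel 'X_{1..s}) (V : {set 'rV[K]_s}) (J : set {mpoly K[s]}) d :
    graded_monomial_order le ->
    (forall a, J 'X_[a] ->
       exists f, vanishing_ideal V f /\ is_lead_monomial le f a) ->
    (forall a, ~ J 'X_[a] -> (mdeg a <= d)%N) ->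
  (#|V| <= #|[set a : 'X_{1..s < d.+1} | ~~ `[< J 'X_[bmnm a] >]]%SET|)%N.
Proof.
move=> hle JV Jd; set T := [set a | _]%SET.
have VI := vanishing_ideal_is_ideal V.
apply: (independent_leq_spanning
  (b := fun i : 'I_#|T| => 'X_[bmnm (enum_val i)])
  (c := fun j : 'I_#|V| => point_indicator (enum_val j)) VI) => [j|]; last first.
  exact: point_indicators_free.
set g := point_indicator _.
(* Division takes place in degree [msize g], since [g] itself may exceed degree [d]. *)
have [a /contrapT/JV//||f [_ fT fg]] :=
    normal_form hle (T := fun a => ~ J 'X_[a]) (d := msize g) (g := g) VI.
  by rewrite /deg_le /=.
exists (fun i => f@_(bmnm (enum_val i))); rewrite -mpoly_sum_enum // => a af.
have lta : (mdeg a < d.+1)%N by apply/Jd/fT.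
by exists (BMultinom lta); rewrite // inE; apply/asboolPn/fT.
Qed.

Theorem corollary3p10 (K : finFieldType) (s : nat) (X : {set 'rV[K]_s})
  (le : rel 'X_{1..s}) (hle : graded_monomial_order le)
  (d r : nat) (hd : (1 <= d)%N)
  (hr : (1 <= r <= affine_hilbert (vanishing_ideal X) d)%N) :
  footprint le (vanishing_ideal X) d r
    <= (gen_hamming_weight (reed_muller_code X d) r)%:R.
Proof.
have [_ /exists_subcode[D0 [D0C D0r]]] := andP hr.
rewrite /gen_hamming_weight; set W := [set w | _]%classic.
have [D [DC dimD ->]] : W (nat_min W).
  by apply: nat_min_mem; exists #|code_support D0|, D0.
have := dim_leq_lead_monomials hle DC; rewrite dimD.
set L := lead_monomials _ _ _; rewrite cardE => rL.
pose M : {set 'X_{1..s < d.+1}} := [set a in take r (enum L)]%SET.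
have ML a : a \in M -> a \in L by rewrite inE => /mem_take; rewrite mem_enum.
have Mr : #|M| == r.
  by rewrite cardsE (card_uniqP _) ?take_uniq ?enum_uniq // size_takel.
have XI := vanishing_ideal_is_ideal X; set I := vanishing_ideal X in XI *.
pose J := ideal_gen (initial_ideal le I `|`
  [set g | exists2 a, a \in M & g = 'X_[K, bmnm a]])%classic.
have JI : is_ideal J by apply: ideal_gen_is_ideal.
have Jd a : ~ J 'X_[a] -> (mdeg a <= s * #|K|)%N.
  move=> nJa; apply: (standard_monomial_bounded (X := X) hle) => ina.
  by apply: nJa; apply: sub_ideal_gen; left.
have JX : forall f, J f -> forall a, a \in msupp f -> J 'X_[a].
  apply: ideal_gen_msuppX => g [gin a ag|[b bM ->] a].
    by apply: sub_ideal_gen; left; apply: initial_ideal_msuppX ag.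
  by rewrite msuppX inE => /eqP->; apply: sub_ideal_gen; right; exists b.
(* It suffices to treat the generators: those in the initial ideal come from polynomials vanishing
   on all of [X], those in [M] from polynomials with values in [D]. *)
have JV a : J 'X_[a] -> exists f,
    vanishing_ideal (common_zeros D) f /\ is_lead_monomial le f a.
  move=> Ja; apply: (ideal_gen_msupp (a := a) (Q := fun a => exists f,
    vanishing_ideal (common_zeros D) f /\ is_lead_monomial le f a) _ _ Ja).
  - move=> b c [f [fV fb]]; exists (f * 'X_[c]); split.
      by have [_ _ VM] := vanishing_ideal_is_ideal (common_zeros D);
         rewrite mulrC; apply: VM.
    exact: is_lead_monomialM.
  - move=> g [gin b bg|[b /ML + ->] c].
      have [f [fX fb]] := initial_idealX hle XI (initial_ideal_msuppX gin bg).
      exists f; split=> //; apply: vanishing_common_zeros.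
      by rewrite (proj2 (eval_row_eq0 _ _) fX) mem0v.
    rewrite inE => /asboolP[_ [f [fD fb]]]; rewrite msuppX inE => /eqP->.
    by exists f; split=> //; apply: vanishing_common_zeros.
  - by rewrite msuppX mem_head.
rewrite /footprint lerBlDl degree_quot_vanishing_ideal.
have -> : #|X|%:R = #|common_zeros D|%:R + #|code_support D|%:R :> rat.
  by rewrite -natrD card_common_zeros.
rewrite lerD2r.
(* The maximum is subtracted in the footprint, so the single set [M] gives the required bound. *)
apply: le_trans (le_bigmax_cond _ _ (j := M) _); last first.
  by rewrite Mr; apply/asboolP => a /ML; rewrite inE => /asboolP[].
rewrite (degree_quot_monomial JI JX Jd) ler_nat.
exact: card_leq_standard_monomials hle JV Jd.
Qed.
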